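(* For every integer $n\geq 5$ there exists a simple arrangement of $n$ planes in $\mathbb{R}^3$ with exactly $(n-4)(2n-3)+5$ external facets.
   Context: An arrangement $\mathcal{A}_{d,n}$ of $n$ (distinct) hyperplanes (affine, in $\mathbb{R}^d$) is called simple if $n\geq d+1$ and any $d$ of the hyperplanes intersect at a distinct point (i.e. any $d$ hyperplanes meet in exactly one point, and different choices of $d$ hyperplanes give different points). For $d=3$ this means $n\ge 4$, any three planes meet in exactly one point, and no four planes share a point. The cells of the arrangement are the closures of the connected components of the complement of the union of the hyperplanes. For $k=0,\dots,d-1$, the $k$-faces of the arrangement are the $k$-faces of its cells (each cell being a polyhedron). A facet of the arrangement is a $(d-1)$-face; for $d=3$ the facets are the (bounded or unbounded) 2-dimensional polygonal regions into which each plane is divided by the other planes. A facet is called external if it belongs to exactly one bounded cell; equivalently, it is a bounded facet which belongs to an unbounded cell. *)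

(* Defs.v *)
From mathcomp Require Import all_boot all_order all_algebra.
From mathcomp Require Import all_classical all_reals all_analysis.

Set Implicit Arguments.
Unset Strict Implicit.
Unset Printing Implicit Defensive.

Import Order.TTheory GRing.Theory Num.Theory.
Import numFieldNormedType.Exports.

Local Open Scope classical_set_scope.
Local Open Scope ring_scope.

Definition dotp (R : realType) (d : nat) (x y : 'rV[R]_d) : R :=
  \sum_(i < d) x ord0 i * y ord0 i.

Definition is_hyperplane (R : realType) (d : nat) (H : set 'rV[R]_d) : Prop :=
  exists (a : 'rV[R]_d) (b : R), a != 0 /\ H = [set x | dotp a x = b].

Definition is_arrangement (R : realType) (d n : nat)
    (H : 'I_n -> set 'rV[R]_d) : Prop :=
  injective H /\ forall i, is_hyperplane (H i).

Definition is_simple (R : realType) (d n : nat)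
    (H : 'I_n -> set 'rV[R]_d) : Prop :=
  [/\ (d.+1 <= n)%N,
      forall S : {set 'I_n}, #|S| = d ->
        exists p, \bigcap_(i in [set` S]) H i = [set p] &
      forall S T : {set 'I_n}, #|S| = d -> #|T| = d -> S <> T ->
        \bigcap_(i in [set` S]) H i <> \bigcap_(i in [set` T]) H i].

Definition arr_complement (R : realType) (d n : nat)
    (H : 'I_n -> set 'rV[R]_d) : set 'rV[R]_d :=
  ~` \bigcup_i H i.

Definition is_cell (R : realType) (d n : nat)
    (H : 'I_n -> set 'rV[R]_d) (C : set 'rV[R]_d) : Prop :=
  exists2 x, arr_complement H x &
    C = closure (connected_component (arr_complement H) x).

(* [A] contains [k + 1] affinely independent points: [x] and [x + row i V]. *)
Definition affine_dim_ge (R : realType) (d : nat)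
    (A : set 'rV[R]_d) (k : nat) : Prop :=
  exists (x : 'rV[R]_d) (V : 'M[R]_(k, d)),
    [/\ A x, forall i, A (x + row i V) & row_free V].

Definition affine_dim (R : realType) (d : nat)
    (A : set 'rV[R]_d) (k : nat) : Prop :=
  affine_dim_ge A k /\ ~ affine_dim_ge A k.+1.

(* A face is cut out by a valid inequality [dotp c x <= b]; taking [c = 0]
   gives the polyhedron itself ([b = 0]) and the empty face ([b = 1]). *)
Definition is_face (R : realType) (d : nat) (P F : set 'rV[R]_d) : Prop :=
  exists (c : 'rV[R]_d) (b : R),
    (forall x, P x -> dotp c x <= b) /\ F = [set x | P x /\ dotp c x = b].

Definition is_kface (R : realType) (d : nat) (k : nat)
    (P F : set 'rV[R]_d) : Prop :=
  is_face P F /\ affine_dim F k.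

Definition arr_kface (R : realType) (d n : nat) (k : nat)
    (H : 'I_n -> set 'rV[R]_d) (F : set 'rV[R]_d) : Prop :=
  exists2 C, is_cell H C & is_kface k C F.

Definition arr_facet (R : realType) (d n : nat)
    (H : 'I_n -> set 'rV[R]_d) (F : set 'rV[R]_d) : Prop :=
  arr_kface d.-1 H F.

Definition external_facet (R : realType) (d n : nat)
    (H : 'I_n -> set 'rV[R]_d) (F : set 'rV[R]_d) : Prop :=
  arr_facet H F /\
  exists! C, [/\ is_cell H C, bounded_set C & F `<=` C].

(* Main.v *)
Require Import Defs.
From mathcomp Require Import all_boot all_order all_algebra.
From mathcomp Require Import all_classical all_reals all_analysis.
From mathcomp Require Import ring lra zify.

Set Implicit Arguments.
Unset Strict Implicit.
Unset Printing Implicit Defensive.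

Import Order.TTheory GRing.Theory Num.Theory.
Import numFieldNormedType.Exports.

Local Open Scope classical_set_scope.
Local Open Scope card_scope.
Local Open Scope ring_scope.

(** Why the theorem holds. A point x of the space is read as the cubic
P_x(t) = x0 + x1 t + x2 t^2 - t^3, and plane i, for 0 <= i < n, is the set of x
with P_x(i) = 0, except for plane 2, which is P_x(2) = - n^3. With the equation
P_x(2) = 0 instead, this would be the cyclic arrangement, which has
2 (n - 2) (n - 3) external facets, that is n - 5 too many; the shift moves
plane 2 beyond all the vertices of the other planes.

A cell is the set of points whose values have a given word of signs. A word is
realized by a cell when it is compatible with the number of roots of a
polynomial (predicate realized). If letter 2 is positive, the constraint on
P_x(2) is void for cubics with roots in [-1, n], so the other letters just have
to be the signs of a cubic positive at minus infinity: they have at most three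
changes, counted from an initial plus. If letter 2 is negative, then x is so
large that t^3 is negligible: the whole word has to be the sign word of a
quadratic polynomial, with at most two changes. Sufficiency is shown by placing
roots between consecutive nodes (realized_cell). Necessity (cell_realized)
comes from divided differences: the values of P_x at four nodes satisfy an
affine relation with coefficients of alternating signs, which forbids some
alternating signs at four planes. The same relation shows that a cell whose
word alternates at four planes is bounded (alternating_bounded), while a cell
whose opposite word is realized contains a ray (ccell_unbounded). A realized
word is bounded exactly when letter 2 is positive and the whole word has at
least three changes (bounded_wordP).

For an arbitrary arrangement, the facets are the walls between two cells whose
words differ by one letter (kface_wall, in_wall_between). Therefore the external
facets correspond to the pairs of a bounded word and a letter whose flip gives a
realized unbounded word (card_external_facets).

These pairs are counted in sum_external. Once the first four letters are fixed,
the conditions only depend on the number of sign changes in the rest of the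
word, and the number of words, or of flips, with a prescribed effect on the
number of changes satisfies a Pascal-like recursion on the length. *)

(** * Linear algebra of normals *)

Section DotProduct.
Variables (R : realType) (d : nat).
Implicit Types (a x y : 'rV[R]_d) (t : R).

Lemma dotpC a x : dotp a x = dotp x a.
Proof. by apply: eq_bigr => i _; rewrite mulrC. Qed.

Lemma dotpD a x y : dotp a (x + y) = dotp a x + dotp a y.
Proof. by rewrite -big_split; apply: eq_bigr => i _; rewrite mxE mulrDr. Qed.

Lemma dotpZ a t x : dotp a (t *: x) = t * dotp a x.
Proof. by rewrite mulr_sumr; apply: eq_bigr => i _; rewrite mxE mulrCA. Qed.

Lemma dotpZl t a x : dotp (t *: a) x = t * dotp a x.
Proof. by rewrite dotpC dotpZ dotpC. Qed.

Lemma dotp_sum a (I : finType) (v : I -> 'rV[R]_d) :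
  dotp a (\sum_i v i) = \sum_i dotp a (v i).
Proof.
rewrite /dotp exchange_big /=; apply: eq_bigr => i _.
by rewrite summxE mulr_sumr.
Qed.

Lemma dotp_gt0 a : a != 0 -> 0 < dotp a a.
Proof.
move=> a0; rewrite lt_neqAle eq_sym; apply/andP; split; last first.
  by apply: sumr_ge0 => i _; rewrite -expr2 sqr_ge0.
apply: contra a0 => /eqP aa0; apply/eqP/rowP => i; rewrite mxE.
have /eqP := aa0; rewrite psumr_eq0; last by move=> j _; rewrite -expr2 sqr_ge0.
by move=> /allP/(_ i (mem_index_enum i)); rewrite mulf_eq0 orbb => /eqP.
Qed.

Lemma mulmx_tr_dotp m (V : 'M[R]_(m, d)) a :
  V *m a^T = 0 <-> forall k, dotp a (row k V) = 0.
Proof.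
have E k : (V *m a^T) k ord0 = dotp a (row k V).
  by rewrite mxE; apply: eq_bigr => j _; rewrite !mxE mulrC.
split=> [Va k|Va]; first by rewrite -E Va mxE.
by apply/matrixP => k j; rewrite ord1 E Va mxE.
Qed.

Lemma dotp_continuous a : continuous (dotp a : 'rV[R]_d -> R).
Proof.
move=> x.
apply: (@continuous_big R 'I_d +%R 0 predT (@add_continuous R)) => i _ {}x.
by apply: (@cvgM R _ (nbhs x)); [exact: cvg_cst | exact: coord_continuous].
Qed.

End DotProduct.

(** The annihilator of d independent vectors is a line. *)
Lemma normal_unique (R : fieldType) d (V : 'M[R]_(d, d.+1)) (a c : 'rV[R]_d.+1) :
  row_free V -> a != 0 -> V *m a^T = 0 -> V *m c^T = 0 ->
  exists t, c = t *: a.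
Proof.
move=> /eqP rV a0 Va Vc.
have sub (u : 'rV_d.+1) : V *m u^T = 0 -> (u <= kermx V^T)%MS.
  by move=> Vu; apply/sub_kermxP; rewrite -[u]trmxK -trmx_mul Vu trmx0.
have rK : \rank (kermx V^T) = 1%N by rewrite mxrank_ker mxrank_tr rV subSnn.
apply/sub_rVP/(submx_trans (sub c Vc)).
by rewrite -(mxrank_leqif_sup (sub a Va)) rK rank_rV a0.
Qed.

Lemma orth_basis (R : fieldType) d (a : 'rV[R]_d.+1) : a != 0 ->
  exists2 V : 'M[R]_(d, d.+1), row_free V & V *m a^T = 0.
Proof.
move=> a0.
have : \rank (kermx a^T) = d by rewrite mxrank_ker mxrank_tr rank_rV a0 subn1.
move: (row_base_free (kermx a^T)) (eq_row_base (kermx a^T)).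
move: (row_base _) => V + + rK; move: V; rewrite rK => V fV eV.
by exists V => //; apply/sub_kermxP; rewrite eV.
Qed.

(** * Signs and cells *)

(** The boolean e stands for the sign of t expected in a word of signs: [side e t]
is positive exactly when t has that sign. *)
Definition side (R : realType) (e : bool) (t : R) : R := if e then t else - t.

Section Side.
Variable R : realType.
Implicit Types (e : bool) (s t : R).

Lemma sideD e s t : side e (s + t) = side e s + side e t.
Proof. by case: e => //=; rewrite opprD. Qed.

Lemma sideM e s t : side e (s * t) = s * side e t.
Proof. by case: e => //=; rewrite mulrN. Qed.

Lemma side0 e : side e 0 = 0 :> R.
Proof. by case: e => //=; rewrite oppr0. Qed.

Lemma sideN e t : side (~~ e) t = - side e t.
Proof. by case: e => //=; rewrite opprK. Qed.

Lemma side_inj e1 e2 t : 0 < side e1 t -> 0 <= side e2 t -> e1 = e2.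
Proof. by case: e1 e2 => [] [] //=; lra. Qed.

Lemma side_pos t : t != 0 -> 0 < side (0 < t) t.
Proof. by rewrite /side; case: (ltgtP 0 t) => //= t0; rewrite oppr_gt0. Qed.

Lemma side_near s t : 0 < s -> \forall e \near 0^'+, 0 < s + e * t.
Proof.
move=> s0; near=> e.
have e0 : 0 < e by near: e; exact: nbhs_right_gt.
have : e < s / (`|t| + 1).
  by near: e; apply: nbhs_right_lt; rewrite divr_gt0// ltr_wpDl.
rewrite ltr_pdivlMr; last by rewrite ltr_wpDl.
move=> es.
have : - t <= `|t| by rewrite -normrN ler_norm.
nra.
Unshelve. all: end_near. Qed.

End Side.

Definition flip n (w : n.-tuple bool) (i : 'I_n) : n.-tuple bool :=
  [tuple (tnth w j) (+) (i == j) | j < n].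

Definition opp n (w : n.-tuple bool) : n.-tuple bool := map_tuple negb w.

Lemma tnth_flip n (w : n.-tuple bool) i j :
  tnth (flip w i) j = tnth w j (+) (i == j).
Proof. by rewrite tnth_mktuple. Qed.

Lemma flipK n (w : n.-tuple bool) i : flip (flip w i) i = w.
Proof. by apply: eq_from_tnth => j; rewrite !tnth_flip -addbA addbb addbF. Qed.

(** The cells of an arbitrary arrangement given by equations. *)
Section Arrangement.
Variables (R : realType) (d n : nat).
Variables (a : 'I_n -> 'rV[R]_d.+1) (b : 'I_n -> R).
Implicit Types (i j : 'I_n) (w v : n.-tuple bool) (x y z : 'rV[R]_d.+1).

Definition aff i x : R := dotp (a i) x - b i.

Definition plane i : set 'rV[R]_d.+1 := [set x | dotp (a i) x = b i].

Definition cell w : set 'rV[R]_d.+1 :=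
  [set x | forall i, 0 < side (tnth w i) (aff i x)].

Definition ccell w : set 'rV[R]_d.+1 :=
  [set x | forall i, 0 <= side (tnth w i) (aff i x)].

Definition signs x : n.-tuple bool := [tuple 0 < aff i x | i < n].

Lemma planeE i x : plane i x <-> aff i x = 0.
Proof. by rewrite /plane /aff /=; split=> [->|/subr0_eq //]; rewrite subrr. Qed.

Lemma aff_shift i x t y : aff i (x + t *: y) = aff i x + t * dotp (a i) y.
Proof. by rewrite /aff dotpD dotpZ addrAC. Qed.

Lemma aff_line i x t y :
  aff i (x + t *: (y - x)) = (1 - t) * aff i x + t * aff i y.
Proof.
rewrite aff_shift -scaleN1r dotpD dotpZ /aff; ring.
Qed.

Lemma aff_continuous i : continuous (aff i).
Proof.
move=> x; apply: (@cvgB _ _ _ (nbhs x)); last exact: cvg_cst.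
exact: dotp_continuous.
Qed.

Lemma cell_sub_ccell w : cell w `<=` ccell w.
Proof. by move=> x wx i; apply: ltW. Qed.

Lemma cell_inj w v x : cell w x -> ccell v x -> w = v.
Proof.
by move=> wx vx; apply: eq_from_tnth => i; exact: side_inj (wx i) (vx i).
Qed.

Lemma complementE x : arr_complement plane x <-> forall i, aff i x != 0.
Proof.
split=> [cx i|cx [i _ /planeE]]; last by apply/eqP.
by apply/negP => /eqP /planeE xi; apply: cx; exists i.
Qed.

Lemma cell_complement w x : cell w x -> arr_complement plane x.
Proof.
move=> wx; apply/complementE => i; apply: contraTneq (wx i) => ->.
by rewrite side0 ltxx.
Qed.

Lemma cell_signs x : arr_complement plane x -> cell (signs x) x.
Proof. by move=> /complementE cx i; rewrite tnth_mktuple side_pos. Qed.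

Definition segment x y : set 'rV[R]_d.+1 :=
  (fun t => x + t *: (y - x)) @` `[0, 1]%classic.

Lemma segment_connected_rV x y : connected (segment x y).
Proof.
apply: connected_continuous_connected; first exact: segment_connected.
apply: continuous_subspaceT => t; apply: cvgD; first exact: cvg_cst.
by apply: cvgZ; [exact: cvg_id | exact: cvg_cst].
Qed.

(** Signs cannot change along a connected set avoiding the hyperplanes, and the
points with given signs aff a convex set. *)
Lemma component_cell x : arr_complement plane x ->
  connected_component (arr_complement plane) x = cell (signs x).
Proof.
move=> cx; have wx := cell_signs cx; apply/seteqP; split=> y.
  move=> [B [Bx Bc Bconn] By] i; move: (wx i).
  have /connected_intervalP I : connected (aff i @` B).
    apply: connected_continuous_connected => //.
    by apply: continuous_subspaceT; exact: aff_continuous.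
  have n0 : ~ (aff i @` B) 0.
    by move=> [z Bz z0]; move/complementE: (Bc _ Bz) => /(_ i)/eqP.
  case: (tnth _ i) => /= sx; rewrite ltNge; apply/negP => sy; apply: n0.
    by apply: (I (aff i y) (aff i x)); [exists y|exists x|rewrite sy ltW].
  apply: (I (aff i x) (aff i y)); [by exists x|by exists y|].
  by move: sx sy; lra.
move=> wy; apply: (@connected_component_max _ _ (segment x y)).
- by exists 0; rewrite ?scale0r ?addr0//= in_itv /= lexx ler01.
- move=> _ [t /= t01 <-]; apply: (@cell_complement (signs x)) => i.
  rewrite aff_line sideD !sideM; have := wx i; have := wy i.
  by move: t01; rewrite in_itv /=; nra.
- exact: segment_connected_rV.
by exists 1; rewrite ?scale1r ?subrKC//= in_itv /= lexx ler01.
Qed.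

Lemma ccell_closed w : closed (ccell w).
Proof.
rewrite (_ : ccell w = \bigcap_i (fun x => side (tnth w i) (aff i x)) @^-1`
  [set t | 0 <= t]); last first.
  by apply/seteqP; split=> x wx i; [move=> _; exact: wx | exact: (wx i)].
apply: closed_bigI => i _; apply: preimage_closed; last exact: closed_ge.
move=> x _; case: (tnth w i) => /=; first exact: (@aff_continuous i x).
by apply: (@cvgN _ _ _ (nbhs x)); exact: (@aff_continuous i x).
Qed.

(** Moving from a point of the polyhedron slightly towards a point of the open
cell makes all the inequalities strict. *)
Lemma closure_cell w : cell w !=set0 -> closure (cell w) = ccell w.
Proof.
move=> [x wx]; apply/seteqP; split.
  have /closure_id -> := @ccell_closed w.
  exact: closureS (@cell_sub_ccell w).
move=> y wy B By.
have line0 : y + t *: (x - y) @[t --> 0^'+] --> y.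
  apply: cvg_at_right_filter; rewrite -[X in _ --> X]addr0 -(scale0r (x - y)).
  apply: cvgD; first exact: cvg_cst.
  by apply: cvgZ; [exact: cvg_id | exact: cvg_cst].
have /filter_ex[t [t0 [t1 Bt]]] : \forall t \near 0^'+, 0 < t /\ t < 1 /\ B (y + t *: (x - y)).
  near=> t; split; [|split].
  - by near: t; exact: nbhs_right_gt.
  - by near: t; exact: nbhs_right_lt.
  - by near: t; exact: line0.
exists (y + t *: (x - y)); split=> // i.
rewrite aff_line sideD !sideM; have := wx i; have := wy i; nra.
Unshelve. all: end_near. Qed.

Lemma is_cellP C :
  is_cell plane C <-> exists w, cell w !=set0 /\ C = ccell w.
Proof.
split=> [[x cx ->]|[w [[x wx] ->]]].
  have wx := cell_signs cx; exists (signs x); split; first by exists x.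
  by rewrite component_cell// closure_cell//; exists x.
have cx := cell_complement wx; exists x => //.
have <- : signs x = w by apply: cell_inj (cell_signs cx) (cell_sub_ccell wx).
by rewrite component_cell// closure_cell//; exists x; exact: cell_signs.
Qed.

Lemma cell_near w x y : cell w x -> \forall t \near 0^'+, cell w (x + t *: y).
Proof.
move=> wx; apply: filter_forall => i.
under eq_near do rewrite aff_shift sideD sideM.
exact: side_near.
Qed.

(** * Facets as walls between cells *)

Definition wall w i : set 'rV[R]_d.+1 := ccell w `&` plane i.

(** The relative interior of the wall. Its being inhabited is what makes
[wall w i] a facet. *)
Definition in_wall w i y : Prop :=
  aff i y = 0 /\ forall j, j != i -> 0 < side (tnth w j) (aff j y).

Lemma in_wall_sub w i y : in_wall w i y -> wall w i y.
Proof.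
move=> [yi yj]; split; last exact/planeE.
by move=> j; have [->|/yj/ltW//] := eqVneq j i; rewrite yi side0.
Qed.

Lemma in_wall_flip w i y : in_wall w i y -> in_wall (flip w i) i y.
Proof.
move=> [yi yj]; split=> // j ji.
by rewrite tnth_flip eq_sym (negbTE ji) addbF; apply: yj.
Qed.

(** The segment joining two cells that only disagree about one hyperplane
crosses that hyperplane and no other. *)
Lemma in_wall_between w i :
  cell w !=set0 -> cell (flip w i) !=set0 -> exists y, in_wall w i y.
Proof.
move=> [x wx] [z wz].
have := wx i; have := wz i; rewrite tnth_flip eqxx addbT sideN => zi xi.
have [t [t0 t1 ti]] :
    exists t, [/\ 0 < t, t < 1 & (1 - t) * aff i x + t * aff i z = 0].
  have D : aff i x - aff i z != 0.
    by apply/eqP => D; move: xi zi; rewrite (subr0_eq D); lra.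
  exists (aff i x / (aff i x - aff i z)); split; last by field.
    move: xi zi; case: (tnth w i) => /= xi zi; first by rewrite divr_gt0//; lra.
    by rewrite -mulrNN -invrN divr_gt0//; lra.
  move: xi zi; case: (tnth w i) => /= xi zi.
    by rewrite ltr_pdivrMr; lra.
  by rewrite ltr_ndivrMr; lra.
exists (x + t *: (z - x)); split=> [|j ji]; first by rewrite aff_line.
rewrite aff_line sideD !sideM; have := wx j; have := wz j.
by rewrite tnth_flip eq_sym (negbTE ji) addbF; nra.
Qed.

Hypothesis a_neq0 : forall i, a i != 0.

(** A small step along the normal leads into the cell. *)
Lemma in_wall_cell w i y : in_wall w i y -> cell w !=set0.
Proof.
move=> [yi yj]; pose u := side (tnth w i) 1 *: a i.
suff /filter_ex[t wt] : \forall t \near 0^'+, cell w (y + t *: u).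
  by exists (y + t *: u).
apply: filter_forall => j; under eq_near do rewrite aff_shift sideD sideM.
have [->|ji] := eqVneq j i; last exact/side_near/yj.
near=> t; rewrite yi side0 add0r mulr_gt0//.
have := dotp_gt0 (a_neq0 i); rewrite dotpZ sideM /side.
by case: (tnth w i); lra.
Unshelve. all: end_near. Qed.

(** Around a relative interior point, small displacements along the hyperplane
stay in the wall, which therefore has the dimension of the hyperplane. *)
Lemma wall_kface w i y : in_wall w i y -> is_kface d (ccell w) (wall w i).
Proof.
move=> wy; have [yi yj] := wy; split.
  pose s : R := - side (tnth w i) 1.
  exists (s *: a i), (s * b i); split=> [x wx|].
    rewrite dotpZl; have := wx i; rewrite /aff /s.
    by case: (tnth w i) => /=; rewrite ?opprK ?mulN1r ?mul1r; lra.
  apply/seteqP; split=> x [wx]; rewrite /plane /= => xi; split=> //.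
    by rewrite dotpZl xi.
  by move: xi; rewrite /plane /= dotpZl /s; case: (tnth w i) => /=; rewrite ?opprK; lra.
split.
  have [V Vfree Va] := orth_basis (a_neq0 i).
  have /filter_ex[t [t0 wt]] : \forall t \near 0^'+, 0 < t /\
      forall (k : 'I_d) j, j != i ->
      0 < side (tnth w j) (aff j (y + t *: row k V)).
    near=> t; split; first by near: t; exact: nbhs_right_gt.
    near: t; apply: filter_forall => k; apply: filter_forall => j.
    have [_|ji] := eqVneq j i; first by near=> t.
    have := side_near (side (tnth w j) (dotp (a j) (row k V))) (yj j ji).
    by apply: filterS => t; rewrite aff_shift sideD sideM.
  exists y, (t *: V); split; first exact: in_wall_sub.
    move=> k; rewrite linearZ /=; apply: in_wall_sub; split; last exact: wt.
    by rewrite aff_shift yi (iffLR (mulmx_tr_dotp _ _) Va) mulr0 addr0.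
  by rewrite /row_free mxrank_scale_nz// gt_eqF.
move=> [x [V [[_ /planeE xi] Vx Vfree]]].
have Va : V *m (a i)^T = 0.
  apply/mulmx_tr_dotp => k; have [_ /planeE] := Vx k.
  by rewrite -(scale1r (row k V)) aff_shift xi add0r mul1r scale1r.
have /negP := a_neq0 i; apply; rewrite -trmx_eq0.
by rewrite row_free_unit in Vfree; rewrite -(mulKmx Vfree (a i)^T) Va mulmx0.
Unshelve. all: end_near. Qed.

Lemma barycenter_aff (x : 'rV[R]_d.+1) (V : 'M[R]_(d, d.+1)) c (e : R) :
  d.+1%:R * (dotp c (x + d.+1%:R^-1 *: \sum_k row k V) - e) =
  (dotp c x - e) + \sum_k (dotp c (x + row k V) - e).
Proof.
rewrite dotpD dotpZ dotp_sum.
under [in RHS]eq_bigr do rewrite dotpD addrAC.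
rewrite big_split /= sumr_const card_ord -mulr_natl.
have d0 : d.+1%:R != 0 :> R by rewrite pnatr_eq0.
by rewrite mulrBr mulrDr mulrA divff// mul1r -natr1; ring.
Qed.

Hypothesis plane_inj : injective plane.

(** The barycenter of affinely independent points spanning the face lies on some
hyperplane, since a valid inequality cannot be tight inside the cell; that
hyperplane must then contain the face, so it is the supporting one, and no other
hyperplane passes through the barycenter. *)
Lemma kface_wall w F : cell w !=set0 -> is_kface d (ccell w) F ->
  exists i y, in_wall w i y /\ F = wall w i.
Proof.
move=> [x0 wx0] [[c [e [ce FE]]] [[x [V [Fx FV Vfree]]] Fdim]].
have inF z : F z <-> ccell w z /\ dotp c z = e by rewrite FE.
(* A zero c would make F the whole cell, which is full-dimensional. *)
have c0 : c != 0.
  apply/negP => /eqP c0; apply: Fdim.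
  have dot0 z : dotp c z = 0.
    by rewrite c0 /dotp big1// => i _; rewrite mxE mul0r.
  have /filter_ex[t [t0 wt]] : \forall t \near 0^'+, 0 < t /\
      forall k : 'I_d.+1, cell w (x0 + t *: row k 1%:M).
    near=> t; split; first by near: t; exact: nbhs_right_gt.
    by near: t; apply: filter_forall => k; exact: cell_near.
  have /inF[_ e0] := Fx; rewrite dot0 in e0.
  exists x0, (t *: 1%:M); split.
  - by apply/inF; rewrite dot0; split=> //; exact: cell_sub_ccell.
  - move=> k; apply/inF; rewrite dot0 linearZ /=.
    by split=> //; exact: cell_sub_ccell.
  - by rewrite /row_free mxrank_scale_nz ?mxrank1// gt_eqF.
pose y : 'rV_d.+1 := x + d.+1%:R^-1 *: \sum_k row k V.
have bary c' (e' : R) : d.+1%:R * (dotp c' y - e') = _ := barycenter_aff x V c' e'.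
have d0 : 0 < d.+1%:R :> R by rewrite ltr0n.
have sbary j : d.+1%:R * side (tnth w j) (aff j y) =
    side (tnth w j) (aff j x) + \sum_k side (tnth w j) (aff j (x + row k V)).
  rewrite -sideM bary sideD; congr (_ + _).
  by rewrite -/(aff _ _) (big_morph (side (tnth w j)) (@sideD _ _) (side0 _ _)).
have Vge j k : 0 <= side (tnth w j) (aff j (x + row k V)).
  by have /inF[+ _] := FV k => /(_ j).
have xge j : 0 <= side (tnth w j) (aff j x) by have /inF[+ _] := Fx => /(_ j).
have wy : ccell w y.
  move=> j; rewrite -(pmulr_rge0 _ d0) sbary addr_ge0//.
  by apply: sumr_ge0 => k _.
have ye : dotp c y = e.
  apply: subr0_eq; apply: (mulfI (lt0r_neq0 d0)); rewrite bary mulr0.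
  have /inF[_ ->] := Fx; rewrite subrr add0r big1// => k _.
  by have /inF[_ ->] := FV k; rewrite subrr.
(* A hyperplane through y contains all the points defining y, hence is the
   supporting hyperplane of the face. *)
have supp j : aff j y = 0 -> exists2 t, t != 0 & c = t *: a j /\ e = t * b j.
  move=> yj; have := sbary j; rewrite yj side0 mulr0 => /esym/eqP.
  rewrite paddr_eq0//; last by apply: sumr_ge0 => k _.
  rewrite psumr_eq0 => [/andP[/eqP xj /allP Vj]|k _//].
  have form0 z : side (tnth w j) (aff j z) = 0 -> aff j z = 0.
    by case: (tnth w j) => //= /eqP; rewrite oppr_eq0 => /eqP.
  have xj0 := form0 _ xj.
  have Va : V *m (a j)^T = 0.
    apply/mulmx_tr_dotp => k; have /implyP/(_ isT)/eqP/form0 := Vj k (mem_index_enum k).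
    by rewrite -(scale1r (row k V)) aff_shift xj0 add0r mul1r scale1r.
  have Vc : V *m c^T = 0.
    apply/mulmx_tr_dotp => k; have /inF[_] := FV k; have /inF[_ <-] := Fx.
    by rewrite dotpD => /(canRL (addKr _)); rewrite addNr.
  have [t ct] := normal_unique Vfree (a_neq0 j) Va Vc.
  exists t; first by apply: contraNneq c0 => t0; rewrite ct t0 scale0r.
  split=> //; have /inF[_ <-] := Fx; rewrite ct dotpZl.
  by congr (_ * _); apply: subr0_eq.
(* Otherwise y is interior to the cell, and moving from y in the direction c
   violates the inequality defining the face. *)
have [i yi] : exists i, aff i y = 0.
  apply: contrapT => noi.
  have wy' : cell w y.
    move=> j; rewrite lt_neqAle wy andbT eq_sym; apply/negP => /eqP yj.
    by apply: noi; exists j; move: yj; case: (tnth w j) => //= /eqP; rewrite oppr_eq0 => /eqP.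
  have /filter_ex[t [t0 wt]] : \forall t \near 0^'+, 0 < t /\ cell w (y + t *: c).
    near=> t; split; first by near: t; exact: nbhs_right_gt.
    by near: t; exact: cell_near.
  have := ce _ (cell_sub_ccell wt); rewrite dotpD dotpZ ye gerDl.
  by rewrite leNgt mulr_gt0// dotp_gt0.
have [t t0 [ct et]] := supp i yi.
have planeF z : plane i z <-> dotp c z = e.
  rewrite /plane /= ct et dotpZl; split=> [->//|].
  exact: (mulfI t0).
exists i, y; split; last first.
  by rewrite FE; apply/seteqP; split=> z [wz]; [move/planeF|move/planeF].
split=> // j ji; rewrite lt_neqAle wy andbT eq_sym.
apply: contra ji => /eqP yj; apply/eqP; apply: plane_inj.
have yj0 : aff j y = 0.
  by move: yj; case: (tnth w j) => //= /eqP; rewrite oppr_eq0 => /eqP.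
have [s s0 [cs es]] := supp j yj0.
have planeF' z : plane j z <-> dotp c z = e.
  rewrite /plane /= cs es dotpZl; split=> [->//|].
  exact: (mulfI s0).
by apply/seteqP; split=> z; [move/planeF'/planeF|move/planeF/planeF'].
Unshelve. all: end_near. Qed.


Lemma in_wall_ccell w v i y :
  in_wall w i y -> ccell v y -> v = w \/ v = flip w i.
Proof.
move=> [yi yj] vy.
have vw j : j != i -> tnth v j = tnth w j.
  by move=> ji; apply/esym; exact: side_inj (yj j ji) (vy j).
have [vwi|vwi] := eqVneq (tnth v i) (tnth w i); [left|right];
    apply: eq_from_tnth => j; rewrite ?tnth_flip; have [<-|ij] := eqVneq i j => //.
- by rewrite vw // eq_sym.
- by move: vwi; case: (tnth v i) (tnth w i) => [] [].
- by rewrite addbF vw // eq_sym.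
Qed.

Lemma wall_flip w i : wall (flip w i) i = wall w i.
Proof.
apply/seteqP; split=> x [wx xi]; split=> // j; have := wx j; rewrite tnth_flip;
  by have [<-|_] := eqVneq i j; rewrite ?addbF// (iffLR (planeE _ _) xi) !side0.
Qed.

(** The realized words T and, among them, the words B of bounded cells are
abstract here: the external facets can be counted from these two predicates. *)
Section ExternalFacets.
Variables T B : pred (n.-tuple bool).
Hypothesis TP : forall w, T w <-> cell w !=set0.
Hypothesis BP : forall w, T w -> B w <-> bounded_set (ccell w).

Definition external w i :=
  [&& T w, B w, T (flip w i) & ~~ B (flip w i)].

(** A relative interior point of a wall lies in no cell other than the two cells
separated by the wall, so the wall is in exactly one bounded cell when exactly
one of these two is bounded. *)
Lemma external_facetP F :
  external_facet plane F <-> exists w i, external w i /\ F = wall w i.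
Proof.
split.
  move=> [[_ /is_cellP[u [u0 ->]] uF] [C [[/is_cellP[v [v0 ->]] vb Fv] Cuniq]]].
  have [i [y [uy FE]]] := kface_wall u0 uF.
  have fuy : cell (flip u i) !=set0 := in_wall_cell (in_wall_flip uy).
  have vy : ccell v y by apply: Fv; rewrite FE; exact: in_wall_sub.
  have [vi fv0] : F = wall v i /\ cell (flip v i) !=set0.
    by have [->|->] := in_wall_ccell uy vy; rewrite ?wall_flip ?flipK.
  exists v, i; split=> //; apply/and4P; split; [exact/TP| |exact/TP|].
    by apply/BP => //; exact/TP.
  apply/negP => /BP bf; have {bf} fb := bf (iffRL (TP _) fv0).
  have E : ccell v = ccell (flip v i).
    apply: Cuniq; split=> //; first by apply/is_cellP; exists (flip v i).
    by rewrite vi -wall_flip => x [].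
  have [x vx] := v0; have := cell_sub_ccell vx; rewrite E => /(cell_inj vx) vf.
  by have := congr1 (fun w => tnth w i) vf; rewrite tnth_flip eqxx addbT; case: (tnth v i).
move=> [w [i [/and4P[/[dup] Tw /TP w0 /(BP Tw) wb /[dup] Tf /TP f0 fb] ->]]].
have [y wy] := in_wall_between w0 f0.
split; first by exists (ccell w); [apply/is_cellP; exists w | exact: wall_kface wy].
exists (ccell w); split.
  by split=> //; [apply/is_cellP; exists w | move=> x []].
move=> _ [/is_cellP[v [v0 ->]] vb wv].
have [-> //|vf] := in_wall_ccell wy (wv _ (in_wall_sub wy)).
by case/negP: fb; apply/BP => //; rewrite -vf.
Qed.

Lemma wall_inj w v i j y z : in_wall w i y -> in_wall v j z ->
  wall w i = wall v j -> i = j /\ (w = v \/ w = flip v i).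
Proof.
move=> wy vz E; have [vy yj] : wall v j y by rewrite -E; exact: in_wall_sub.
have ji : i = j.
  apply/eqP/negPn/negP => ij; have [_ /(_ j)] := wy.
  by rewrite eq_sym ij (iffLR (planeE _ _) yj) side0 ltxx => /(_ isT).
split=> //; have [->|->] := in_wall_ccell wy vy; [by left|right].
by rewrite flipK.
Qed.

(** An external facet is determined by its bounded cell and its plane. *)
Lemma card_external_facets :
  ([set F | external_facet plane F] #=
    `I_(\sum_(w : n.-tuple bool) \sum_(i < n) external w i))%card.
Proof.
pose E := [pred p : n.-tuple bool * 'I_n | external p.1 p.2].
have -> : (\sum_(w : n.-tuple bool) \sum_(i < n) external w i)%N = #|E|.
  rewrite -sum1_card pair_bigA big_mkcond [RHS]big_mkcond /=.
  apply: eq_bigr => p _; rewrite -[RHS]/(if external p.1 p.2 then 1 else 0)%N.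
  by case: (external _ _).
pose e (k : 'I_#|E|) := @enum_val _ (mem E) k.
have extE k : external (e k).1 (e k).2 by have := @enum_valP _ (mem E) k.
pose f (k : 'I_#|E|) := wall (e k).1 (e k).2.
have -> : [set F | external_facet plane F] = f @` [set: 'I_#|E|].
  apply/seteqP; split=> F.
    move=> /external_facetP[w [i [wi ->]]].
    have wiE : (w, i) \in E by [].
    by exists (enum_rank_in wiE (w, i)) => //; rewrite /f /e enum_rankK_in.
  by move=> [k _ <-]; apply/external_facetP; exists (e k).1, (e k).2.
apply: (card_eq_trans _ (card_esym card_II)).
apply: inj_card_eq => k l _ _; rewrite /f => E_kl; apply: enum_val_inj.
rewrite -/(e k) -/(e l); have := extE k; have := extE l; move: E_kl.
case: (e k) (e l) => w i [v j] /= E_kl.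
move=> /and4P[Tv Bv Tfv _] /and4P[Tw Bw Tfw Bfw].
have [y wy] := in_wall_between (iffLR (TP w) Tw) (iffLR (TP _) Tfw).
have [z vz] := in_wall_between (iffLR (TP v) Tv) (iffLR (TP _) Tfv).
have [ij [-> //|wv]] := wall_inj wy vz E_kl; first by rewrite ij.
by move: Bfw; rewrite wv flipK Bv.
Qed.

End ExternalFacets.

(** If x lies in a cell and y in the opposite one, the cell contains the ray
from x pointing away from y. *)
Lemma ccell_unbounded w (i0 : 'I_n) : cell w !=set0 -> cell (opp w) !=set0 ->
  ~ bounded_set (ccell w).
Proof.
move=> [x wx] [y wy] /pinfty_ex_gt0[M M0 wM].
have xy : 0 < `|x - y|.
  rewrite normr_gt0 subr_eq0; apply/eqP => xy; move: (wx i0) (wy i0).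
  by rewrite tnth_map xy sideN; lra.
pose t := (M + `|x| + 1) / `|x - y|.
have t0 : 0 < t by rewrite divr_gt0// !ltr_wpDr// ?addr_ge0.
have : ccell w (x + t *: (x - y)).
  move=> i; rewrite aff_shift -(scaleN1r y) dotpD dotpZ.
  have -> : aff i x + t * (dotp (a i) x + -1 * dotp (a i) y) =
    (1 + t) * aff i x + (- t) * aff i y by rewrite /aff; ring.
  rewrite sideD !sideM; have := wx i; have := wy i.
  by rewrite tnth_map sideN; nra.
move=> /wM /=; apply/negP; rewrite -ltNge.
have : `|t *: (x - y)| <= `|x + t *: (x - y)| + `|x|.
  by rewrite -{1}(addKr x (t *: _)) addrC; apply: le_trans (ler_normB _ _) _.
rewrite normrZ (gtr0_norm t0) /t divfK ?gt_eqF//; lra.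
Qed.

End Arrangement.

(** * Counting flips of sign words *)

Section Words.
Local Open Scope nat_scope.
Implicit Types (a b c d e : bool) (u v w : seq bool) (i j k n : nat).

(** The letter a is the one with which the first letter of w is compared. *)
Fixpoint changes a w : nat :=
  if w is b :: w' then a (+) b + changes b w' else 0.

(** The words of signs of the cells. If the third letter, which belongs to the
shifted plane, is positive, then the other letters are the signs of a cubic that
is positive at minus infinity; if it is negative, all the letters are the signs
of a quadratic polynomial. *)
Definition realized w : bool :=
  if w is [:: a, b, c & v] then
    if c then changes true [:: a, b & v] <= 3 else changes a [:: b, c & v] <= 2
  else false.

(** The realized words whose opposite is not realized. *)
Definition bounded_word w : bool :=
  if w is [:: a, b, c & v] then
    [&& c, realized w & 3 <= changes a [:: b, c & v]]
  else false.

Fixpoint words n : seq (seq bool) :=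
  if n is n'.+1 then
    [seq true :: v | v <- words n'] ++ [seq false :: v | v <- words n']
  else [:: [::]].

Arguments words : simpl never.

Fixpoint flips w : seq (seq bool) :=
  if w is b :: w' then (~~ b :: w') :: [seq b :: v | v <- flips w'] else [::].

Lemma sum_words n (F : seq bool -> nat) :
  \sum_(v <- words n.+1) F v =
  \sum_(v <- words n) F (true :: v) + \sum_(v <- words n) F (false :: v).
Proof. by rewrite big_cat !big_map. Qed.

Lemma sum_words_sym n d (F : seq bool -> nat) :
  \sum_(v <- words n.+1) F v =
  \sum_(v <- words n) F (d :: v) + \sum_(v <- words n) F (~~ d :: v).
Proof. by rewrite sum_words; case: d => //; rewrite addnC. Qed.

Lemma sum_tuple_words n (F : seq bool -> nat) :
  \sum_(w : n.-tuple bool) F w = \sum_(v <- words n) F v.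
Proof.
elim: n F => [|n IHn] F.
  rewrite big_seq1 (bigD1 [tuple]) //= big1 ?addn0// => w /eqP[].
  exact: tuple0.
rewrite sum_words -!IHn.
pose h (p : bool * n.-tuple bool) := [tuple of p.1 :: p.2].
pose h' (w : n.+1.-tuple bool) := (thead w, [tuple of behead w]).
rewrite (reindex h); last first.
  exists h' => [[b w] _|w _]; last by rewrite [RHS]tuple_eta.
  by congr pair; apply: val_inj.
rewrite -(pair_bigA _ (fun b (w : n.-tuple bool) => F (b :: w))) /=.
by rewrite big_bool.
Qed.

Lemma size_flips w : size (flips w) = size w.
Proof. by elim: w => //= b w IHw; rewrite size_map IHw. Qed.

Lemma nth_flips w i : i < size w ->
  nth [::] (flips w) i = mkseq (fun j => nth false w j (+) (i == j)) (size w).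
Proof.
rewrite /mkseq; elim: w i => // b w IHw [_|i iw] /=.
  congr cons; first by rewrite addbT.
  apply: (@eq_from_nth _ false); first by rewrite size_map size_iota.
  move=> j jw; rewrite (nth_map 0) ?size_iota// nth_iota//.
  by rewrite addbF.
rewrite (nth_map [::]) ?size_flips// IHw //; congr cons.
  by rewrite addbF.
rewrite -(addn0 1) iotaDl -map_comp; apply: eq_map => j /=.
by rewrite add1n eqSS.
Qed.

Lemma sum_flip n (w : n.-tuple bool) (P : pred (seq bool)) :
  \sum_(i < n) P (flip w i) = count P (flips w).
Proof.
rewrite -sum1_count [RHS]big_mkcond (big_nth [::]) size_flips size_tuple big_mkord.
apply: eq_bigr => i _; rewrite nth_flips ?size_tuple//.
rewrite (_ : mkseq _ n = flip w i); first by case: (P _).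
apply: (@eq_from_nth _ false); first by rewrite size_mkseq size_tuple.
move=> j; rewrite size_mkseq => jn; rewrite nth_mkseq//.
by rewrite -[j]/(val (Ordinal jn)) -!tnth_nth tnth_flip.
Qed.

(** A word is determined by the positions of its sign changes. *)
Lemma changes_dist n d j :
  \sum_(v <- words n) (changes d v == j) = 'C(n, j).
Proof.
elim: n d j => [|n IHn] d j; first by rewrite big_seq1; case: j.
rewrite (sum_words_sym _ d) /= addbb addbN addbb /=.
rewrite IHn; case: j => [|j]; first by rewrite big1 ?bin0.
by rewrite binS; congr addn; exact: IHn.
Qed.

(** For a nonempty word, the numbers of changes counted from d and from its
opposite differ by exactly one, the larger one being that of the sign opposite
to the first letter. *)
Lemma changes_dist2 n d (P : nat -> nat -> bool) :
  \sum_(v <- words n.+1) P (changes d v) (changes (~~ d) v) =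
  \sum_(v <- words n) P (changes d v) (changes d v).+1 +
  \sum_(v <- words n) P (changes (~~ d) v).+1 (changes (~~ d) v).
Proof.
by rewrite (sum_words_sym _ d) /= !addbb addbN addNb addbb.
Qed.

(** The number of single flips leading from a word of length n with i changes to
a word with at most j changes. *)
Definition moves n d i j : nat :=
  \sum_(v <- words n) (changes d v == i) * count (fun u => changes d u <= j) (flips v).

(** The four terms distinguish whether the first letter agrees with d, and whether
it is the letter that is flipped. *)
Lemma moves_rec n d i j : moves n.+1 d i j =
  \sum_(v <- words n)
     ((changes d v == i) && ((changes (~~ d) v).+1 <= j)) + moves n d i j +
  (\sum_(v <- words n)
     (((changes (~~ d) v).+1 == i) && (changes d v <= j)) +
   if (i, j) is (i'.+1, j'.+1) then moves n (~~ d) i' j' else 0).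
Proof.
rewrite /moves (sum_words_sym _ d) /= !addbb addbN addbb negbK.
congr addn.
  rewrite -big_split /=; apply: eq_bigr => v _.
  rewrite ?addbN ?addbb count_map mulnDr mulnb; congr (_ + _ * _).
  by apply: eq_count => u /=; rewrite ?addbb.
transitivity (\sum_(v <- words n) (((changes (~~ d) v).+1 == i) && (changes d v <= j)) +
  \sum_(v <- words n) ((changes (~~ d) v).+1 == i) *
     count (fun u => (changes (~~ d) u).+1 <= j) (flips v)).
  rewrite -big_split /=; apply: eq_bigr => v _.
  rewrite ?addbb count_map mulnDr mulnb; congr (_ + _ * _).
  by apply: eq_count => u /=; rewrite ?addbN ?addbb.
congr addn; case: i => [|i]; first by rewrite big1.
case: j => [|j] //; rewrite big1 // => v _.
by rewrite (@eq_count _ _ pred0) ?count_pred0 ?muln0.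
Qed.


Lemma changes_neg_lip d v : changes (~~ d) v <= (changes d v).+1.
Proof. by case: v => [|b v] //; case: d; case: b; rewrite /=; lia. Qed.

Lemma sum0 n (P : seq bool -> bool) :
  (forall v, ~~ P v) -> \sum_(v <- words n) P v = 0.
Proof. by move=> P0; apply: big1 => v _; rewrite (negbTE (P0 v)). Qed.

Lemma changes_up n d i j : j <= i.+1 ->
  \sum_(v <- words n.+1) (((changes (~~ d) v).+1 == i.+2) && (changes d v <= j)) =
  (i <= j) * 'C(n, i).
Proof.
move=> ji.
rewrite (changes_dist2 _ _ (fun x y => (y.+1 == i.+2) && (x <= j))).
rewrite -[RHS]addn0 -(changes_dist n d) big_distrr /=; congr addn.
  by apply: eq_bigr => v _; lia.
by apply: sum0 => v; apply/negP; lia.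
Qed.

Lemma moves1 n d : moves n d 1 0 = (0 < n).
Proof.
elim: n d => [|n IHn] d; first by rewrite /moves big_seq1.
rewrite moves_rec IHn sum0; last by move=> v; rewrite andbF.
rewrite add0n addn0; case: n {IHn} => [|n]; first by rewrite big_seq1.
by rewrite (changes_dist2 _ _ (fun x y => (y.+1 == 1) && (x <= 0))) !sum0 // => v;
  apply/negP; lia.
Qed.

Lemma moves20 n d : moves n d 2 0 = n.-1.
Proof.
elim: n d => [|n IHn] d; first by rewrite /moves big_seq1.
rewrite moves_rec IHn sum0; last by move=> v; rewrite andbF.
case: n {IHn} => [|n]; first by rewrite big_seq1.
by rewrite changes_up//= bin0; lia.
Qed.

Lemma moves21 n d : moves n d 2 1 = n.-1.*2.
Proof.
elim: n d => [|n IHn] d; first by rewrite /moves big_seq1.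
rewrite moves_rec IHn moves1 sum0; last first.
  by move=> v; have := changes_neg_lip (~~ d) v; rewrite negbK; lia.
case: n {IHn} => [|n]; first by rewrite big_seq1.
by rewrite changes_up//= bin0; lia.
Qed.

Lemma moves32 n d : moves n d 3 2 = 3 * 'C(n.-1, 2).
Proof.
elim: n d => [|n IHn] d; first by rewrite /moves big_seq1.
rewrite moves_rec IHn moves21 sum0; last first.
  by move=> v; have := changes_neg_lip (~~ d) v; rewrite negbK; lia.
case: n {IHn} => [|n]; first by rewrite big_seq1.
by rewrite changes_up//= binS bin1; lia.
Qed.

(** The number of external facets charged to the word w, each external facet being
charged to the bounded cell containing it. *)
Definition ext_flips w : nat :=
  if bounded_word w then
    count (fun u => realized u && ~~ bounded_word u) (flips w)
  else 0.

Definition tail_flips d j v := count (fun u => changes d u <= j) (flips v).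

(** The contribution of a word depends on its first four letters, on the number
of sign changes of the rest read after either value of the fourth letter, and on
the flips of the rest. *)
Lemma ext_flips_head a b c d v :
  let x := changes d v in let y := changes (~~ d) v in
  ext_flips [:: a, b, c, d & v] =
  if ~~ c || (~~ a && b) || (~~ a && ~~ b && d) then 0
  else if a && b && d then (x == 3) * tail_flips d 2 v
  else if a && b then ((x == 2) && (y <= 2)) + (x == 2) * tail_flips d 1 v
  else if a && d then (x == 1).*2 + (x == 1) * tail_flips d 0 v
  else if a then (x == 0) + (x <= 1).*2 + (y == 0)
  else ((x == 1) + (x == 2) + ((0 < x <= 2) && (y <= 1)) +
        ((x == 1) * tail_flips d 0 v + (x == 2) * tail_flips d 0 v)).
Proof.
move=> x y; have := changes_neg_lip d v; have := changes_neg_lip (~~ d) v.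
rewrite negbK -/x -/y /ext_flips /= !count_map {}/x {}/y => l1 l2.
case: a b c d l1 l2 => [] [] [] [] //= l1 l2.
all: try by case: ifP => //; lia.
all: set K := count (preim _ _) _.
- have -> : K = tail_flips true 2 v by apply: eq_count => u /=; lia.
  by move: (tail_flips _ _ _) => {}K; case: ifP => H; case: eqP; rewrite ?mul1n; lia.
- have -> : K = tail_flips false 1 v by apply: eq_count => u /=; lia.
  by move: (tail_flips _ _ _) => {}K; case: ifP => H; case: eqP; rewrite ?mul1n; lia.
- have -> : K = tail_flips true 0 v by apply: eq_count => u /=; lia.
  by move: (tail_flips _ _ _) => {}K; case: ifP => H; case: eqP; rewrite ?mul1n; lia.
- have -> : K = 0 by rewrite /K (@eq_count _ _ pred0) ?count_pred0// => u /=; lia.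
  by case: ifP; lia.
- have -> : K = tail_flips false 0 v by apply: eq_count => u /=; lia.
  move: (tail_flips _ _ _) => {}K; case: ifP => H; case: eqP; case: eqP;
  by rewrite ?mul1n; lia.
Qed.

Lemma bounded_realized w : bounded_word w -> realized w.
Proof. by case: w => [|a [|b [|c v]]] //= /and3P[]. Qed.

Lemma sum_ext_flips_head m a b c d :
  \sum_(v <- words m.+1) ext_flips [:: a, b, c, d & v] =
  if ~~ c || (~~ a && b) || (~~ a && ~~ b && d) then 0
  else if a && b && d then 3 * 'C(m, 2)
  else if a && b then 3 * m
  else if a && d then 2 * m + 3
  else if a then 2 * m + 6
  else 'C(m.+1, 2) + 3 * m + 3.
Proof.
under eq_bigr do rewrite ext_flips_head.
do ![case: ifP => _]; rewrite ?big_split ?sum_nat_const /=; first by rewrite big1.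
- exact: moves32.
- rewrite -/(moves _ _ 2 1) moves21.
  rewrite (changes_dist2 _ _ (fun x y => (x == 2) && (y <= 2))) sum0.
    transitivity (0 + \sum_(v <- words m) (changes (~~ d) v == 1) + m.*2); last first.
      by rewrite changes_dist bin1; lia.
    by congr (_ + _ + _); apply: eq_bigr => v _; lia.
  by move=> v; apply/negP; lia.
- rewrite -/(moves _ _ 1 0) moves1.
  under eq_bigr do rewrite -addnn.
  by rewrite big_split /= changes_dist bin1; lia.
- have -> : \sum_(v <- words m.+1) (changes d v <= 1).*2 = 2 * m.+2.
    transitivity (\sum_(v <- words m.+1) 2 * ((changes d v == 0) + (changes d v == 1))).
      by apply: eq_bigr => v _; lia.
    by rewrite -big_distrr big_split /= !changes_dist bin0 bin1.
  by rewrite !changes_dist !bin0; lia.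
- rewrite -/(moves _ _ 1 0) -/(moves _ _ 2 0) moves1 moves20.
  rewrite !changes_dist bin1.
  rewrite (changes_dist2 _ _ (fun x y => (0 < x <= 2) && (y <= 1))) sum0.
    transitivity (m.+1 + 'C(m.+1, 2) + (0 + \sum_(v <- words m)
       ((changes (~~ d) v == 0) + (changes (~~ d) v == 1))) + (1 + m)).
      by congr (_ + (_ + _) + _); apply: eq_bigr => v _; lia.
    by rewrite big_split /= !changes_dist bin0 bin1; lia.
  by move=> v; apply/negP; lia.
Qed.

Lemma sum_ext_flips m :
  \sum_(w <- words m.+4.+1) ext_flips w =
  'C(m.+1, 2) + 3 * 'C(m, 2) + 10 * m + 12.
Proof.
rewrite !(sum_words m.+4) !(sum_words m.+3) !(sum_words m.+2) !(sum_words m.+1).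
by rewrite !sum_ext_flips_head /=; lia.
Qed.

Lemma sum_external n : 5 <= n ->
  \sum_(w <- words n) ext_flips w = (n - 4) * (2 * n - 3) + 5.
Proof.
move=> /subnKC <-; move: (n - 5) => m; rewrite sum_ext_flips.
by elim: m => // m IHm; rewrite !binS !bin1 bin0 in IHm *; nia.
Qed.

End Words.

(** * Positions of the sign changes *)

Section Cuts.
Local Open Scope nat_scope.
Implicit Types (a b : bool) (w : seq bool) (c i j k : nat).

(** The positions of the letters of w that differ from their predecessor, the
first letter of w having position k and predecessor a. *)
Fixpoint cuts a k w : seq nat :=
  if w is b :: w' then
    if a (+) b then k :: cuts b k.+1 w' else cuts b k.+1 w'
  else [::].

Lemma size_cuts a k w : size (cuts a k w) = changes a w.
Proof. by elim: w a k => //= b w IHw a k; case: addb; rewrite /= IHw. Qed.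

Lemma cuts_bounds a k w : all (fun c => k <= c < k + size w) (cuts a k w).
Proof.
elim: w a k => //= b w IHw a k.
have H : all (fun c => k <= c < k + (size w).+1) (cuts b k.+1 w).
  by apply: sub_all (IHw b k.+1) => c; lia.
by case: addb => //=; rewrite H andbT; lia.
Qed.

Lemma cuts_sorted a k w : sorted ltn (cuts a k w).
Proof.
elim: w a k => //= b w IHw a k; case: addb; last exact: IHw.
rewrite /= path_sortedE; last exact: ltn_trans.
rewrite IHw andbT.
by apply: sub_all (cuts_bounds b k.+1 w) => c /andP[].
Qed.

Lemma nth_at_cut a k w j : j < changes a w ->
  nth false w (nth 0 (cuts a k w) j - k) = a (+) ~~ odd j.
Proof.
elim: w a k j => //= b w IHw a k j.
have step i : i < changes b w ->
    nth false (b :: w) (nth 0 (cuts b k.+1 w) i - k) = b (+) ~~ odd i.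
  move=> iw; rewrite -(IHw b k.+1 i iw).
  have : k.+1 <= nth 0 (cuts b k.+1 w) i.
    have /allP/(_ (nth 0 (cuts b k.+1 w) i)) := cuts_bounds b k.+1 w.
    by rewrite mem_nth ?size_cuts// => /(_ isT)/andP[].
  by case: (nth 0 _ i) => // m km; rewrite subSn.
case ab: (a (+) b) => /=; last first.
  by rewrite add0n => /step ->; case: (a) (b) ab => [] [].
case: j => [_|j /step /= ->].
  by rewrite /= subnn; case: (a) (b) ab => [] [].
by case: (a) (b) ab => [] [] // _; case: (odd j).
Qed.

Lemma nth_cuts a k w i : i < size w ->
  nth false w i = a (+) odd (count (fun c => c <= k + i) (cuts a k w)).
Proof.
elim: w a k i => //= b w IHw a k [_|i iw].
  have -> : count (fun c => c <= k + 0) (if a (+) b then k :: cuts b k.+1 w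
      else cuts b k.+1 w) = (a (+) b).
    have H : count (fun c => c <= k + 0) (cuts b k.+1 w) = 0.
      apply/eqP; rewrite -leqn0 leqNgt -has_count; apply/hasPn => c cw.
      by have /allP/(_ c cw) := cuts_bounds b k.+1 w; lia.
    by case: (a (+) b); rewrite /= H; lia.
  by case: a b => [] [].
rewrite [LHS](IHw b k.+1 i iw) addSnnS.
by case: a; case: b; rewrite /= ?leq_addr ?add1n /= ?negbK.
Qed.

(** Exactly k positions are wanted, as a polynomial of degree k has k roots: the
list of sign changes is padded with a position beyond the word, which does not
affect the parities. *)
Lemma roots_of_word a k w : changes a w <= k ->
  exists2 L : seq nat, size L = k /\ all (fun c => c <= size w) L &
    forall i, i < size w -> nth false w i = a (+) odd (count (fun c => c <= i) L).
Proof.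
move=> wk; exists (cuts a 0 w ++ nseq (k - changes a w) (size w)).
  split; first by rewrite size_cat size_nseq size_cuts subnKC.
  rewrite all_cat all_nseq leqnn orbT andbT.
  by apply: sub_all (cuts_bounds a 0 w) => c; lia.
move=> i iw; rewrite count_cat count_nseq leqNgt iw mul0n addn0.
by rewrite (nth_cuts a 0 iw).
Qed.

Lemma cut_lt a k w i j : i < j < changes a w ->
  nth 0 (cuts a k w) i < nth 0 (cuts a k w) j.
Proof.
move=> /andP[ij jw]; apply: (sorted_ltn_nth ltn_trans) => //.
- exact: cuts_sorted.
- by rewrite inE size_cuts (ltn_trans ij).
- by rewrite inE size_cuts.
Qed.

Lemma cut_range a k w j : j < changes a w ->
  k <= nth 0 (cuts a k w) j < k + size w.
Proof.
move=> jw; have /allP := cuts_bounds a k w; apply.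
by rewrite mem_nth ?size_cuts.
Qed.

Lemma changes_map_negb a w : changes (~~ a) (map negb w) = changes a w.
Proof.
by elim: w a => //= b w IHw a; rewrite IHw addbN addNb negbK.
Qed.

(** Reversing the signs preserves the number of changes inside the word; only the
letter of the shifted plane and the initial plus require care. *)
Lemma realized_opp w : realized w -> ~~ bounded_word w -> realized (map negb w).
Proof.
case: w => [|a [|b [|e w]]] //=.
have := changes_neg_lip true w; have := changes_neg_lip false w.
have /= := changes_map_negb true w; have /= := changes_map_negb false w.
by case: a; case: b; case: e => /=; lia.
Qed.

End Cuts.

(** * Cubics with leading coefficient -1 *)

Section Cubics.
Variable R : realType.
Implicit Types (x : 'rV[R]_3) (t : R).

Definition cubic x t : R :=
  x ord0 (inord 0) + x ord0 (inord 1) * t + x ord0 (inord 2) * t ^+ 2 - t ^+ 3.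

Definition coefs (p q r : R) : 'rV[R]_3 := \row_(k < 3) nth 0 [:: p; q; r] k.

Lemma cubic_coefs p q r t :
  cubic (coefs p q r) t = p + q * t + r * t ^+ 2 - t ^+ 3.
Proof. by rewrite /cubic !mxE !inordK. Qed.

(** The Vandermonde determinant of three nodes. *)
Definition vdm3 (t1 t2 t3 : R) := (t2 - t1) * (t3 - t1) * (t3 - t2).

Lemma vdm3_gt0 t1 t2 t3 : t1 < t2 -> t2 < t3 -> 0 < vdm3 t1 t2 t3.
Proof. by move=> *; rewrite /vdm3 !mulr_gt0 ?subr_gt0//; lra. Qed.

(** The third divided difference of a cubic is its leading coefficient, here -1;
the denominators have been cleared. *)
Lemma divided_difference x t1 t2 t3 t4 :
  vdm3 t2 t3 t4 * cubic x t1 - vdm3 t1 t3 t4 * cubic x t2 +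
  vdm3 t1 t2 t4 * cubic x t3 - vdm3 t1 t2 t3 * cubic x t4 =
  vdm3 t2 t3 t4 * ((t2 - t1) * (t3 - t1) * (t4 - t1)).
Proof. by rewrite /cubic /vdm3; ring. Qed.

Lemma prod3_lt (M p q r : R) : `|p| < M -> `|q| < M -> `|r| < M ->
  `|p * q * r| < M ^+ 3.
Proof.
move=> pM qM rM; rewrite !normrM exprS expr2 mulrA.
by rewrite !ltr_pM ?mulr_ge0.
Qed.

(** Roots at half-integers stay at distance at least 1/2 from the nodes, which
gives not only the sign of the product but also a lower bound. *)
Lemma sign_prod (L : seq nat) (t : nat) :
  2^-1 ^+ size L <= side (~~ odd (count (fun c => (c <= t)%N) L))
     (\prod_(c <- L) (c%:R - 2^-1 - t%:R : R)).
Proof.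
have p0 k : 0 <= 2^-1 ^+ k :> R by rewrite exprn_ge0.
elim: L => [|c L IHL] /=; first by rewrite big_nil expr0.
rewrite big_cons exprS sideM; have := p0 (size L); move: IHL.
have [ct|tc] := leqP c t; rewrite ?add1n ?add0n /= ?sideN.
  have : (c%:R : R) <= t%:R by rewrite ler_nat.
  by move: (side _ _) (_ ^+ _) => p q ct' qp q0; nra.
have : (t%:R : R) + 1 <= c%:R by rewrite natr1 ler_nat.
by move: (side _ _) (_ ^+ _) => p q ct' qp q0; nra.
Qed.

End Cubics.

(** * The arrangement *)

(** The inverse matrix recovers the coordinates of x from those of [x *m A]. *)
Lemma bounded_mulmx (R : realType) d (A : 'M[R]_d.+1) (S : set 'rV[R]_d.+1) (C : R) :
  A \in unitmx -> (forall x, S x -> forall k, `|(x *m A) ord0 k| <= C) ->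
  bounded_set S.
Proof.
move=> Au SC; pose Q := \sum_k \sum_j `|invmx A k j|.
have Q0 : 0 <= Q by apply: sumr_ge0 => k _; apply: sumr_ge0 => j _.
suff SQ x : S x -> `|x| <= `|C| * Q.
  exists (`|C| * Q); split; first exact: num_real.
  by move=> M CM x /SQ xQ; rewrite /= (le_trans xQ)// ltW.
move=> Sx; rewrite [`|x|]mx_normrE; apply/bigmax_leP; split=> [|[i j] _ /=].
  by rewrite mulr_ge0.
rewrite -{1}(mulmxK Au x) mxE (le_trans (ler_norm_sum _ _ _))//.
rewrite /Q mulr_sumr; apply: ler_sum => k _; rewrite normrM ler_pM//.
  by rewrite ord1 (le_trans (SC x Sx k))// ler_norm.
by rewrite (bigD1 j)//= lerDl sumr_ge0.
Qed.

Section Construction.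
Variables (R : realType) (n : nat).
Hypothesis n5 : (5 <= n)%N.
Implicit Types (x : 'rV[R]_3) (w : n.-tuple bool).

(** This exceeds in absolute value any product of three differences between 2 and
points of [-1, n], in particular the value at 2 of any cubic whose three roots
are nodes. *)
Let N : R := n%:R ^+ 3.

Definition normal (i : 'I_n) : 'rV[R]_3 := \row_(k < 3) i%:R ^+ k.

Definition offset (i : 'I_n) : R := i%:R ^+ 3 - (i == 2%N :> nat)%:R * N.

(** The values compared with 0 to get the word of signs, indexed by natural
numbers rather than ordinals. *)
Definition val_at (i : nat) x : R := cubic x i%:R + (i == 2%N)%:R * N.

Lemma aff_val_at i x : aff normal offset i x = val_at i x.
Proof.
rewrite /aff /dotp !big_ord_recr big_ord0 /= !mxE /val_at /cubic /offset.
have E (k : nat) (k3 : (k < 3)%N) (j : 'I_3) : j = k :> nat -> j = inord k.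
  by move=> jk; apply: val_inj; rewrite /= inordK.
do ![rewrite [_ ord0 (widen_ord _ _)](congr1 (x ord0) (E _ _ _ erefl)) //=].
rewrite [_ ord0 ord_max](congr1 (x ord0) (E _ _ _ erefl)) //=.
ring.
Qed.

Lemma normal_neq0 i : normal i != 0.
Proof.
by apply/eqP => /rowP/(_ ord0); rewrite !mxE expr0 => /eqP; rewrite oner_eq0.
Qed.

Lemma nodes_unit (f : 'I_3 -> 'I_n) : injective f ->
  Vandermonde 3 (\row_k (f k)%:R : 'rV[R]_3) \in unitmx.
Proof.
move=> f_inj; rewrite unitmxE unitfE det_Vandermonde.
apply/prodf_neq0 => i _; apply/prodf_neq0 => j ij; rewrite !mxE subr_eq0 eqr_nat.
by apply: contraTneq ij => /val_inj/f_inj ->; rewrite ltnn.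
Qed.

Lemma mul_Vandermonde (f : 'I_3 -> 'I_n) x k :
  (x *m Vandermonde 3 (\row_k (f k)%:R)) ord0 k = dotp (normal (f k)) x.
Proof. by rewrite mxE; apply: eq_bigr => j _; rewrite !mxE mulrC. Qed.

Lemma N_gt0 : 0 < N.
Proof. by rewrite exprn_gt0// ltr0n; lia. Qed.

Lemma prod_from2_lt i j k : (i < n)%N -> (j < n)%N -> (k < n)%N ->
  `|(i%:R - 2) * (j%:R - 2) * (k%:R - 2)| < N.
Proof.
move=> i_n j_n k_n.
have H m : (m < n)%N -> `|m%:R - 2 : R| < n%:R.
  move=> mn; rewrite ltr_norml; apply/andP; split.
    have : (5%:R : R) <= n%:R by rewrite ler_nat.
    have : 0 <= m%:R :> R by []. lra.
  have : (m%:R : R) < n%:R by rewrite ltr_nat.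
  lra.
by apply: prod3_lt; exact: H.
Qed.

Definition weight (i j k : nat) : R := vdm3 i%:R j%:R k%:R.

Lemma weight_gt0 i j k : (i < j)%N -> (j < k)%N -> 0 < weight i j k.
Proof. by move=> ij jk; apply: vdm3_gt0; rewrite ltr_nat. Qed.

(** The right-hand side does not depend on x: this is the affine dependency
between four of the planes. *)
Lemma dependency x i1 i2 i3 i4 :
  weight i2 i3 i4 * val_at i1 x - weight i1 i3 i4 * val_at i2 x +
  weight i1 i2 i4 * val_at i3 x - weight i1 i2 i3 * val_at i4 x =
  weight i2 i3 i4 * ((i2%:R - i1%:R) * (i3%:R - i1%:R) * (i4%:R - i1%:R)) +
  N * (weight i2 i3 i4 * (i1 == 2%N)%:R - weight i1 i3 i4 * (i2 == 2%N)%:R +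
       weight i1 i2 i4 * (i3 == 2%N)%:R - weight i1 i2 i3 * (i4 == 2%N)%:R).
Proof. by rewrite -(divided_difference x) /val_at /weight; ring. Qed.

(** The cubic of a point common to four planes has at least three nodes other than
2 as roots, so its value at the fourth node is neither 0 nor - N. *)
Lemma no_four_meet x i1 i2 i3 i4 : uniq [:: i1; i2; i3; i4] ->
  all (fun i => i < n)%N [:: i1; i2; i3; i4] ->
  ~ [/\ val_at i1 x = 0, val_at i2 x = 0, val_at i3 x = 0 & val_at i4 x = 0].
Proof.
move=> U /=/and5P[l1 l2 l3 l4 _] [z1 z2 z3 z4].
have := dependency x i1 i2 i3 i4; rewrite z1 z2 z3 z4 !mulr0 !subr0 add0r.
have := prod_from2_lt l2 l3 l4; have := prod_from2_lt l1 l3 l4.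
have := prod_from2_lt l1 l2 l4; have := prod_from2_lt l1 l2 l3.
have Vn i j k : uniq [:: i; j; k] -> weight i j k != 0.
  rewrite /= !inE !negb_or andbT => /andP[/andP[ij ik] jk].
  by rewrite /weight /vdm3 !mulf_neq0// subr_eq0 eqr_nat eq_sym.
have key (P Q : R) : `|P| < N -> Q != 0 -> Q * (N + P) <> 0.
  move=> PN Q0 /eqP; rewrite mulf_eq0 (negbTE Q0) /= => /eqP NP.
  move: PN; rewrite (_ : P = - N) ?normrN; last by lra.
  by rewrite ger0_norm ?ltxx//; exact/ltW/N_gt0.
have V1 : weight i2 i3 i4 != 0 by apply: Vn; move: U; rewrite /= !inE; lia.
have V2 : weight i1 i3 i4 != 0 by apply: Vn; move: U; rewrite /= !inE; lia.
have V3 : weight i1 i2 i4 != 0 by apply: Vn; move: U; rewrite /= !inE; lia.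
have V4 : weight i1 i2 i3 != 0 by apply: Vn; move: U; rewrite /= !inE; lia.
have [d2 d3 d4] : [/\ i2 != i1, i3 != i1 & i4 != i1].
  by move: U; rewrite /= !inE; split; lia.
move=> p4 p3 p2 p1 /esym; have [e1|n1] := eqVneq i1 2%N.
  have [-> [-> ->]] : (i2 == 2%N) = false /\ (i3 == 2%N) = false /\ (i4 == 2%N) = false by lia.
  rewrite e1 in V1 *; move=> E; apply: (key _ _ p1 V1); rewrite -[RHS]E /=; ring.
have [e2|n2] := eqVneq i2 2%N.
  have [-> ->] : (i3 == 2%N) = false /\ (i4 == 2%N) = false.
    by move: U; rewrite /= !inE; lia.
  rewrite e2 in V2 *; move=> E; apply: (key _ _ p2 V2).
  by rewrite -[RHS]oppr0 -[in RHS]E /weight /vdm3 /=; ring.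
have [e3|n3] := eqVneq i3 2%N.
  have -> : (i4 == 2%N) = false by move: U; rewrite /= !inE; lia.
  rewrite e3 in V3 *; move=> E; apply: (key _ _ p3 V3).
  by rewrite -[RHS]E /weight /vdm3 /=; ring.
have [e4|n4] := eqVneq i4 2%N.
  rewrite e4 in V4 *; move=> E; apply: (key _ _ p4 V4).
  by rewrite -[RHS]oppr0 -[in RHS]E /weight /vdm3 /=; ring.
rewrite /= !mulr0 !subr0 !addr0 mulr0 addr0 => /eqP; apply/negP.
apply: (mulf_neq0 V1); apply: mulf_neq0; [apply: mulf_neq0|];
  by rewrite subr_eq0 eqr_nat.
Qed.


Lemma cell_val w x i : (i < n)%N -> cell normal offset w x ->
  0 < side (nth false w i) (val_at i x).
Proof.
move=> i_n /(_ (Ordinal i_n)).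
by rewrite aff_val_at (tnth_nth false).
Qed.

Lemma ccell_val w x i : (i < n)%N -> ccell normal offset w x ->
  0 <= side (nth false w i) (val_at i x).
Proof.
move=> i_n /(_ (Ordinal i_n)).
by rewrite aff_val_at (tnth_nth false).
Qed.

Definition alternating e w i1 i2 i3 i4 : Prop :=
  [/\ (i1 < i2)%N, (i2 < i3)%N, (i3 < i4)%N & (i4 < n)%N] /\
  [/\ nth false w i1 = e, nth false w i2 = ~~ e,
      nth false w i3 = e & nth false w i4 = ~~ e].

(** The constant value, on any cell with these alternating signs, of a combination
of the four values with positive coefficients (see alternating_sum). *)
Definition alternating_bound e i1 i2 i3 i4 : R :=
  side e (weight i2 i3 i4 * ((i2%:R - i1%:R) * (i3%:R - i1%:R) * (i4%:R - i1%:R)) +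
  N * (weight i2 i3 i4 * (i1 == 2%N)%:R - weight i1 i3 i4 * (i2 == 2%N)%:R +
       weight i1 i2 i4 * (i3 == 2%N)%:R - weight i1 i2 i3 * (i4 == 2%N)%:R)).

Lemma alternating_sum e w i1 i2 i3 i4 x : alternating e w i1 i2 i3 i4 ->
  weight i2 i3 i4 * side (nth false w i1) (val_at i1 x) +
  weight i1 i3 i4 * side (nth false w i2) (val_at i2 x) +
  weight i1 i2 i4 * side (nth false w i3) (val_at i3 x) +
  weight i1 i2 i3 * side (nth false w i4) (val_at i4 x) =
  alternating_bound e i1 i2 i3 i4.
Proof.
case=> _ [-> -> -> ->]; rewrite /alternating_bound -(dependency x) !sideN.
by rewrite /side; case: e; ring.
Qed.

Lemma alternating_weights e w i1 i2 i3 i4 : alternating e w i1 i2 i3 i4 ->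
  [/\ 0 < weight i2 i3 i4, 0 < weight i1 i3 i4, 0 < weight i1 i2 i4 &
      0 < weight i1 i2 i3].
Proof. by case=> [[? ? ? ?] _]; split; apply: weight_gt0 => //; lia. Qed.

Lemma alternating_bound_gt0 e w i1 i2 i3 i4 x :
  alternating e w i1 i2 i3 i4 -> cell normal offset w x ->
  0 < alternating_bound e i1 i2 i3 i4.
Proof.
move=> alt wx; rewrite -(alternating_sum x alt).
have [] := alternating_weights alt; case: alt => [[? ? ? ?] _] *.
by rewrite !addr_gt0// mulr_gt0// cell_val//; lia.
Qed.

(** Four planes met with alternating signs cut out a simplex, so they bound the
cell. *)
Lemma alternating_bounded e w i1 i2 i3 i4 :
  alternating e w i1 i2 i3 i4 -> bounded_set (ccell normal offset w).
Proof.
move=> alt; have [W1 W2 W3 W4] := alternating_weights alt.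
have [[l12 l23 l34 l4n] _] := alt.
have l3n : (i3 < n)%N by lia.
have l2n : (i2 < n)%N by lia.
have l1n : (i1 < n)%N by lia.
pose f (k : 'I_3) : 'I_n := tnth [tuple Ordinal l1n; Ordinal l2n; Ordinal l3n] k.
have f_inj : injective f.
  move=> j k /(congr1 val); rewrite /f !(tnth_nth (Ordinal l1n)).
  by case: j k => [[|[|[|?]]] ?] [[|[|[|?]]] ?] //= jk; apply: val_inj => /=; lia.
pose K := alternating_bound e i1 i2 i3 i4.
pose C := K / weight i2 i3 i4 + K / weight i1 i3 i4 + K / weight i1 i2 i4.
pose D := \sum_i `|offset i|.
apply: (@bounded_mulmx _ _ _ _ (C + D) (nodes_unit f_inj)) => x wx k.
rewrite mul_Vandermonde.
have := alternating_sum x alt; rewrite -/K.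
have := ccell_val l1n wx; have := ccell_val l2n wx; have := ccell_val l3n wx.
have := ccell_val l4n wx.
have abs i : `|val_at i x| = `|side (nth false w i) (val_at i x)|.
  by case: nth; rewrite //= normrN.
have := abs i1; have := abs i2; have := abs i3.
move: (side _ _) (side _ _) (side _ _) (side _ _) => u1 u2 u3 u4 a3 a2 a1 p4 p3 p2 p1 uK.
have K0 : 0 <= K by rewrite -uK !addr_ge0// mulr_ge0// ltW.
have bnd (W u : R) : 0 < W -> 0 <= u -> W * u <= K -> u <= K / W.
  by move=> W0 u0; rewrite ler_pdivlMr// mulrC.
have q1 := mulr_ge0 (ltW W1) p1; have q2 := mulr_ge0 (ltW W2) p2.
have q3 := mulr_ge0 (ltW W3) p3; have q4 := mulr_ge0 (ltW W4) p4.
have c1 := divr_ge0 K0 (ltW W1); have c2 := divr_ge0 K0 (ltW W2).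
have c3 := divr_ge0 K0 (ltW W3).
have fC : `|aff normal offset (f k) x| <= C.
  rewrite aff_val_at /f (tnth_nth (Ordinal l1n)) /C.
  case: k => [[|[|[|?]]] ?] //=.
  - by rewrite a1 ger0_norm//; have := bnd _ _ W1 p1; lra.
  - by rewrite a2 ger0_norm//; have := bnd _ _ W2 p2; lra.
  - by rewrite a3 ger0_norm//; have := bnd _ _ W3 p3; lra.
have -> : dotp (normal (f k)) x = aff normal offset (f k) x + offset (f k).
  by rewrite /aff subrK.
rewrite (le_trans (ler_normD _ _))// lerD// /D (bigD1 (f k))//= lerDl.
exact: sumr_ge0.
Qed.


(** The sign of letter 2 makes the term in N negative, and this term dominates the
other one. *)
Lemma alternating_bound_le0 e w i1 i2 i3 i4 : alternating e w i1 i2 i3 i4 ->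
  nth false w 2%N = false ->
  [|| 2%N == i1, 2%N == i2, 2%N == i3 | 2%N == i4] ->
  alternating_bound e i1 i2 i3 i4 <= 0.
Proof.
move=> alt w2 h2; have [[l12 l23 l34 l4n] [s1 s2 s3 s4]] := alt.
have l13 := ltn_trans l12 l23; have l24 := ltn_trans l23 l34.
have l14 := ltn_trans l13 l34; have l3n := ltn_trans l34 l4n.
have l2n := ltn_trans l23 l3n; have l1n := ltn_trans l12 l2n.
have [W1 W2 W3 W4] := alternating_weights alt.
have n0 := N_gt0.
have lt_sub (i j : nat) : (i < j)%N -> 0 < j%:R - i%:R :> R.
  by move=> ij; rewrite subr_gt0 ltr_nat.
have P1 : 0 < (i2%:R - i1%:R) * (i3%:R - i1%:R) * (i4%:R - i1%:R) :> R.
  by rewrite !mulr_gt0// lt_sub.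
have V1 := mulr_gt0 W1 P1.
have NW1 := mulr_gt0 n0 W1; have NW2 := mulr_gt0 n0 W2.
have NW3 := mulr_gt0 n0 W3; have NW4 := mulr_gt0 n0 W4.
have small (P W : R) : `|P| < N -> 0 < W -> - (W * P) < W * N.
  by rewrite ltr_norml => /andP[PN _] W0; rewrite -mulrN ltr_pM2l// ltrNl.
rewrite /alternating_bound; case: e alt s1 s2 s3 s4 h2 => alt s1 s2 s3 s4 h2.
  have n1 : (i1 == 2%N) = false by apply/eqP => i12; move: s1; rewrite i12 w2.
  have n3 : (i3 == 2%N) = false by apply/eqP => i32; move: s3; rewrite i32 w2.
  rewrite n1 n3 !mulr0.
  have [e2|e4] : i2 = 2%N \/ i4 = 2%N.
    by move: h2; rewrite !(eq_sym 2%N) n1 n3 /= => /orP[]/eqP; [left|right].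
  - have -> : (i4 == 2%N) = false by apply: gtn_eqF; rewrite -e2.
    have := small _ _ (prod_from2_lt l1n l3n l4n) W2.
    by rewrite e2 /= /weight /vdm3; lra.
  - have -> : (i2 == 2%N) = false by apply: ltn_eqF; rewrite -e4.
    have := small _ _ (prod_from2_lt l1n l2n l3n) W4.
    by rewrite e4 /= /weight /vdm3; lra.
have n2 : (i2 == 2%N) = false by apply/eqP => i22; move: s2; rewrite i22 w2.
have n4 : (i4 == 2%N) = false by apply/eqP => i42; move: s4; rewrite i42 w2.
rewrite n2 n4 !mulr0 /= oppr_le0.
have : 0 <= N * weight i2 i3 i4 * (i1 == 2%N)%:R by rewrite mulr_ge0// ltW.
have : 0 <= N * weight i1 i2 i4 * (i3 == 2%N)%:R by rewrite mulr_ge0// ltW.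
lra.
Qed.

Lemma bump_lt (i j : nat) : (i < j -> bump 2%N i < bump 2%N j)%N.
Proof. by rewrite /bump; lia. Qed.

Lemma nth_bump (a b e : bool) v i :
  nth false [:: a, b, e & v] (bump 2%N i) = nth false [:: a, b & v] i.
Proof. by case: i => [|[|i]]. Qed.

(** A word with too many changes alternates at four planes in a way that makes the
constant of alternating_sum nonpositive. If letter 2 is positive, four changes
counted from a plus give a minus, plus, minus, plus pattern avoiding plane 2; if
it is negative, three changes give a pattern including plane 2. *)
Lemma cell_realized w : cell normal offset w !=set0 -> realized w.
Proof.
move=> [x wx]; have noalt e i1 i2 i3 i4 : nth false w 2%N = false ->
    [|| 2%N == i1, 2%N == i2, 2%N == i3 | 2%N == i4] -> ~ alternating e w i1 i2 i3 i4.
  move=> w2 h2 alt; have := alternating_bound_gt0 alt wx.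
  by apply/negP; rewrite -leNgt (alternating_bound_le0 alt).
have sw := size_tuple w.
case E : (val w) => [|a [|b [|e v]]]; try by move: sw; rewrite E /=; lia.
move: sw; rewrite E /= => sv.
have wE i : nth false w i = nth false [:: a, b, e & v] i by rewrite E.
case: e E wE => E wE; rewrite leqNgt; apply/negP => ch.
  pose u := [:: a, b & v].
  pose p j := bump 2%N (nth 0%N (cuts true 0 u) j).
  have pw j : (j < 4)%N -> nth false w (p j) = odd j /\ (p j < n)%N.
    move=> j4; have jch : (j < changes true u)%N by apply: leq_trans ch.
    have := cut_range 0 jch; have := nth_at_cut 0 jch.
    rewrite wE nth_bump subn0 => -> /=; rewrite negbK; split=> //.
    by move: H; rewrite /p /bump /= -sv; lia.
  have alt : alternating false w (p 0) (p 1) (p 2) (p 3).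
    split; split; try by apply/bump_lt/cut_lt; rewrite /= (leq_trans _ ch).
    - by have [] := pw 3 isT.
    - by have [] := pw 0 isT.
    - by have [] := pw 1 isT.
    - by have [] := pw 2 isT.
    - by have [] := pw 3 isT.
  have := alternating_bound_gt0 alt wx.
  have [W1 _ _ _] := alternating_weights alt.
  have [[l1 l2 l3 _] _] := alt.
  have p2 j : (p j == 2%N) = false by apply: negbTE; rewrite eq_sym neq_bump.
  rewrite /alternating_bound !p2 !mulr0 !subr0 !addr0 mulr0 addr0 /= oppr_gt0.
  apply/negP; rewrite -leNgt ltW//; apply: mulr_gt0 => //.
  by apply: mulr_gt0; [apply: mulr_gt0|]; rewrite subr_gt0 ltr_nat;
    [|exact: ltn_trans l2|exact: ltn_trans (ltn_trans l1 l2) l3].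
pose c := nth 0%N (cuts false 3 v).
have cw j : (j < changes false v)%N ->
    [/\ nth false w (c j) = ~~ odd j, (2 < c j)%N & (c j < n)%N].
  move=> jch; have := cut_range 3 jch; have := nth_at_cut 3 jch.
  rewrite -/(c j) => cj /andP[c3 cn]; split=> //; last by rewrite -sv.
  by rewrite wE -(subnKC c3) /= cj.
have c_lt i j : (i < j < changes false v)%N -> (c i < c j)%N by exact: cut_lt.
have w2 : nth false w 2%N = false by rewrite wE.
have w0 : nth false w 0 = a by rewrite wE.
have w1 : nth false w 1 = b by rewrite wE.
case: a b w0 w1 ch {E wE sv} => [] [] w0 w1 /= ch.
- have [] := cw 0%N; first by lia.
  have [] := cw 1%N; first by lia.
  move=> s1 l1 m1 s0 l0 m0; apply: (noalt true 0%N 2%N (c 0%N) (c 1%N)) => //.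
  by do 2![split=> //]; apply: c_lt; lia.
- have [] := cw 0%N; first by lia.
  have [] := cw 1%N; first by lia.
  move=> s1 l1 m1 s0 l0 m0; apply: (noalt true 0%N 2%N (c 0%N) (c 1%N)) => //.
  by do 2![split=> //]; apply: c_lt; lia.
- have [] := cw 0%N; first by lia.
  move=> s0 l0 m0; apply: (noalt false 0%N 1%N 2%N (c 0%N)) => //.
- have [] := cw 0%N; first by lia.
  have [] := cw 1%N; first by lia.
  have [] := cw 2%N; first by lia.
  move=> s2 l2 m2 s1 l1 m1 s0 l0 m0.
  apply: (noalt false 2%N (c 0%N) (c 1%N) (c 2%N)) => //.
  by do 2![split=> //]; apply: c_lt; lia.
Qed.

(** Counted from the sign opposite to the first letter, a bounded word has four
changes. *)
Lemma bounded_word_bounded w : bounded_word w ->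
  bounded_set (ccell normal offset w).
Proof.
have sw := size_tuple w.
case E : (val w) => [|a [|b [|e v]]] //= /and3P[_ _ ch].
pose u := [:: a, b, e & v].
have {}ch : (4 <= changes (~~ a) u)%N by rewrite /u /= addNb addbb.
pose c := nth 0%N (cuts (~~ a) 0 u).
have cw j : (j < 4)%N -> nth false w (c j) = a (+) odd j /\ (c j < n)%N.
  move=> j4; have jch : (j < changes (~~ a) u)%N by apply: leq_trans ch.
  have := cut_range 0 jch; have := nth_at_cut 0 jch.
  rewrite -/(c j) subn0 add0n => cj cn; split; last by rewrite -sw E.
  by rewrite E cj addNb addbN negbK.
apply: (@alternating_bounded a w (c 0%N) (c 1%N) (c 2%N) (c 3%N)).
split; split; try by apply/cut_lt; rewrite /= (leq_trans _ ch).
- by have [] := cw 3 isT.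
- by have [->] := cw 0 isT; rewrite addbF.
- by have [->] := cw 1 isT; rewrite addbT.
- by have [->] := cw 2 isT; rewrite addbF.
- by have [->] := cw 3 isT; rewrite addbT.
Qed.


Lemma val_cell w x :
  (forall i, (i < n)%N -> 0 < side (nth false w i) (val_at i x)) ->
  cell normal offset w x.
Proof. by move=> wx i; rewrite aff_val_at (tnth_nth false) wx. Qed.

(** A root causing a sign change between the nodes c - 1 and c. *)
Let root_at (c : nat) : R := c%:R - 2^-1.

(** If letter 2 is positive, the cubic has its roots where the other letters
change; no root is placed just before node 2, and the bounded roots keep the
value at 2 above - N. If letter 2 is negative, a quadratic polynomial with the
right signs is multiplied by 8 N: as its values at the nodes are at least 1/4 in
absolute value, the multiples dominate both t^3 and N. *)
Lemma realized_cell w : realized w -> cell normal offset w !=set0.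
Proof.
have sw := size_tuple w.
case E : (val w) => [|a [|b [|e v]]] //=.
have wE i : nth false w i = nth false [:: a, b, e & v] i by rewrite E.
have nE : n = (size v).+3 by rewrite -sw E.
have n5' : 5%:R <= n%:R :> R by rewrite ler_nat.
case: e E wE => E wE ch.
  have {}ch : (changes true [:: a, b & v] <= 3)%N by exact: ch.
  have [[|c1 [|c2 [|c3 [|? ?]]]] [//= _ cn] cP] := roots_of_word ch.
  pose r c := root_at (bump 2%N c).
  exists (coefs (r c1 * r c2 * r c3) (- (r c1 * r c2 + r c1 * r c3 + r c2 * r c3))
            (r c1 + r c2 + r c3)).
  set x := coefs _ _ _.
  have xP (t : nat) : cubic x t%:R = (r c1 - t%:R) * (r c2 - t%:R) * (r c3 - t%:R).
    by rewrite cubic_coefs; ring.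
  apply: val_cell => i i_n; have [->|i2] := eqVneq i 2%N.
    rewrite wE /= /val_at xP eqxx mul1r.
    have H c : (c <= (size v).+2)%N -> `|r c - 2%:R| < n%:R.
      move=> cv; have : (bump 2%N c)%:R <= n%:R :> R.
        by rewrite ler_nat nE /bump; lia.
      have : 0 <= (bump 2%N c)%:R :> R by [].
      by rewrite ltr_norml /r /root_at => *; apply/andP; split; lra.
    have [c1n c2n c3n] : [/\ c1 <= (size v).+2, c2 <= (size v).+2 & c3 <= (size v).+2]%N.
      by case/and4P: cn.
    have := prod3_lt (H _ c1n) (H _ c2n) (H _ c3n).
    by rewrite ltr_norml -/N => /andP[]; lra.
  have ib : bump 2%N (unbump 2%N i) = i by rewrite unbumpK// inE.
  have iu : (unbump 2%N i < (size v).+2)%N by move: i_n; rewrite nE -{1}ib /bump; lia.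
  rewrite /val_at (negbTE i2) mul0r addr0 -ib wE nth_bump (cP _ iu) xP ib.
  have := sign_prod R [:: bump 2%N c1; bump 2%N c2; bump 2%N c3] i.
  rewrite !big_cons big_nil mulr1 mulrA -/(root_at _) -/(root_at _) -/(root_at _).
  rewrite /= -{1 2 3}ib !leq_bump2 addn0.
  by apply: lt_le_trans; rewrite !mulr_gt0.
have {}ch : (changes a [:: a, b, false & v] <= 2)%N by rewrite /= addbb.
have [[|c1 [|c2 [|? ?]]] [//= _ cn] cP] := roots_of_word ch.
pose L : R := 8%:R * N.
pose s : R := side a L.
exists (coefs (s * (root_at c1 * root_at c2)) (s * - (root_at c1 + root_at c2)) s).
set x := coefs _ _ _.
have xP (t : nat) : cubic x t%:R = s * ((root_at c1 - t%:R) * (root_at c2 - t%:R)) - t%:R ^+ 3.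
  by rewrite cubic_coefs; ring.
apply: val_cell => i i_n; rewrite /val_at xP.
have := sign_prod R [:: c1; c2] i.
rewrite !big_cons big_nil mulr1 -/(root_at _) -/(root_at _) /=.
set q := (_ * _) => hq.
have i30 : 0 <= i%:R ^+ 3 :> R by apply: exprn_ge0.
have i3N : i%:R ^+ 3 <= N by rewrite lerXn2r ?nnegrE// ler_nat ltnW.
move: (i%:R ^+ 3) i30 i3N => i3 i30 i3N.
have iw : (i < size [:: a, b, false & v])%N by rewrite /= -nE.
have wi := cP i iw; rewrite -wE in wi.
have {}hq : 4^-1 <= side (nth false w i) (side a q).
  rewrite wi; move: hq; rewrite /= addn0 (_ : 2^-1 ^+ 2 = 4^-1); last by field.
  by case: (a); case: (odd _) => /=; rewrite ?opprK.
have n0 := N_gt0.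
have {}hq : 2%:R * N <= side (nth false w i) (s * q).
  have -> : side (nth false w i) (s * q) = L * side (nth false w i) (side a q).
    by rewrite /s; case: (a); case: nth => /=; ring.
  by rewrite /L; nra.
case: (eqVneq i 2%N) hq => [i2|_].
  have -> : nth false w i = false by rewrite i2 wE.
  rewrite /= mul1r => hq.
  by lra.
by case: nth => /= hq; rewrite mul0r; lra.
Qed.

Lemma opp_words w : val (opp w) = map negb w. Proof. by []. Qed.

Lemma bounded_wordP w : realized w ->
  bounded_word w <-> bounded_set (ccell normal offset w).
Proof.
move=> rw; split; first exact: bounded_word_bounded.
move=> bw; apply/negPn/negP => nbw.
have n0 : (0 < n)%N by apply: leq_trans n5.
apply: (ccell_unbounded (Ordinal n0) _ _ bw); apply: realized_cell => //.
by rewrite opp_words realized_opp.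
Qed.

Lemma plane_normal_inj : injective (plane normal offset).
Proof.
have E i p q : plane normal offset i (coefs p q 0) <-> p + q * i%:R = offset i.
  rewrite planeE aff_val_at /val_at cubic_coefs /offset -/N.
  by split=> H; [|move: H]; lra.
move=> i j ij.
have ii : offset i = offset j.
  have : plane normal offset i (coefs (offset i) 0 0) by apply/E; ring.
  by rewrite ij => /E <-; ring.
have : plane normal offset i (coefs (offset i - i%:R) 1 0) by apply/E; ring.
rewrite ij => /E /eqP; rewrite -ii mul1r -subr_eq0 => /eqP H.
by apply/val_inj/eqP; rewrite -(eqr_nat R); apply/eqP => /=; lra.
Qed.

(** Three planes meet in one point because the Vandermonde determinant of their
nodes is nonzero; two triples with the same common point would give a point on
four planes. *)
Lemma plane_simple : is_simple (plane normal offset).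
Proof.
have enum3 (S : {set 'I_n}) : #|S| = 3%N -> exists2 f : 'I_3 -> 'I_n,
    injective f & forall i, i \in S <-> exists k, f k = i.
  move=> S3; exists (fun k => enum_val (cast_ord (esym S3) k)).
    by move=> j k /enum_val_inj/cast_ord_inj.
  move=> i; split=> [iS|[k <-]]; last exact: enum_valP.
  by exists (cast_ord S3 (enum_rank_in iS i)); rewrite cast_ordK enum_rankK_in.
have meet (S : {set 'I_n}) : #|S| = 3%N ->
    exists p, \bigcap_(i in [set` S]) plane normal offset i = [set p].
  move=> /enum3[f f_inj fS].
  pose A := Vandermonde 3 (\row_k (f k)%:R : 'rV[R]_3).
  have Au : A \in unitmx := nodes_unit f_inj.
  pose r : 'rV[R]_3 := \row_k offset (f k).
  exists (r *m invmx A); apply/seteqP; split=> x.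
    move=> xS; rewrite /= -[LHS](mulmxK Au); congr (_ *m _).
    apply/rowP => k; rewrite mul_Vandermonde mxE.
    by apply: (xS (f k)); apply/fS; exists k.
  move=> -> i /fS[k <-]; rewrite /plane /= -mul_Vandermonde mulmxKV//.
  by rewrite mxE.
split; [exact: leq_trans n5 | exact: meet|].
move=> S T S3 T3 ST E.
have [l lT lS] : exists2 l, l \in T & l \notin S.
  apply/subsetPn; apply/negP => TS; apply: ST.
  by apply/esym/eqP; rewrite eqEcard TS S3 T3.
have [f f_inj fS] := enum3 S S3; have [x Sx] := meet S S3.
have xS : (\bigcap_(i in [set` S]) plane normal offset i) x by rewrite Sx.
have zS i : i \in S -> val_at i x = 0.
  by move=> iS; rewrite -aff_val_at; apply/planeE; exact: xS.
have zl : val_at l x = 0.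
  by rewrite -aff_val_at; apply/planeE; rewrite E in xS; exact: xS.
have fk k : f k \in S by apply/fS; exists k.
have o j k : (j < 3)%N -> (k < 3)%N -> j != k -> (f (inord j) : nat) != f (inord k).
  move=> j3 k3; apply: contra => /eqP/val_inj/f_inj/(congr1 val).
  by rewrite /= !inordK// => ->.
have fl k : (f k : nat) != l by apply: contraNneq lS => /val_inj <-.
apply: (@no_four_meet x (f (inord 0)) (f (inord 1)) (f (inord 2)) l).
- by rewrite /= !inE !negb_or !fl !o.
- by rewrite /= !ltn_ord.
- by split=> //; exact: zS.
Qed.

End Construction.

(** * The theorem *)

Theorem mainTheorem4 (R : realType) (n : nat) (hn : (5 <= n)%N) :
  exists H : 'I_n -> set 'rV[R]_3,
    [/\ is_arrangement H,
        is_simple H &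
        [set F | external_facet H F] #= `I_((n - 4) * (2 * n - 3) + 5)%N].
Proof.
exists (plane (@normal R n) (@offset R n)); split.
- split; first exact: plane_normal_inj.
  by move=> i; exists (normal R i), (offset R i); split=> //; exact: normal_neq0.
- exact: plane_simple.
have TP (w : n.-tuple bool) :
    realized w <-> cell (@normal R n) (@offset R n) w !=set0.
  by split; [exact: realized_cell | exact: cell_realized].
suff -> : ((n - 4) * (2 * n - 3) + 5 =
    \sum_(w : n.-tuple bool) \sum_(i < n)
      external (fun w => realized w) (fun w => bounded_word w) w i)%N.
  apply: (@card_external_facets R 2 n _ _ (@normal_neq0 R n)
    (@plane_normal_inj R n) (fun w => realized w) (fun w => bounded_word w) TP).
  exact: bounded_wordP.
rewrite -(sum_external hn) -sum_tuple_words; apply: eq_bigr => w _.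
rewrite /ext_flips; case: ifP => [wb|wb]; last first.
  by rewrite big1// => i _; rewrite /external wb andbF.
rewrite -sum_flip; apply: eq_bigr => i _; rewrite /external wb.
by rewrite (bounded_realized wb).
Qed.
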